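(* Let $k\ge 1$ and $q$ be integers with $1\le q\le k$, and let $a_0>0$, $t>1$ and $K>0$ be real numbers. There exists a constant $c>0$, depending only on $k,q,a_0,t,K$, such that the following holds. Let $\mathcal H$ be a $k$-uniform hypergraph on a vertex set $\Gamma$ with $|\Gamma|=N\ge 1$, let $0<p<1$, put $\mu=|\mathcal H|p^k$, and suppose that (i) $|\mathcal H|/N^q\ge a_0$; (ii) for all integers $0\le j\le q$, $\Delta_j\le K N^{q-j}$; (iii) for all integers $q<j\le k$, $\Delta_j\le K$; (iv) $C>0$ is a real number for which there exists $\Gamma_0\subseteq\Gamma$ such that $|\Gamma_0|\le C\mu^{1/q}$ and $|\mathcal H[\Gamma_0]|\ge t\mu$. Then, with $X=|\mathcal H[\Gamma_p]|$, $$p^{C\mu^{1/q}}=\exp\{-C\mu^{1/q}\log(1/p)\}\le \mathbb P(X\ge t\mu)\le \exp\{-c\mu^{1/q}\}.$$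
   Context: A $k$-uniform hypergraph $\mathcal H$ on a finite vertex set $\Gamma$ is identified with its set of edges, which are $k$-element subsets of $\Gamma$; $|\mathcal H|$ is the number of edges. For $\Gamma'\subseteq\Gamma$, $\mathcal H[\Gamma']$ denotes the set of edges of $\mathcal H$ contained in $\Gamma'$. $\Gamma_p$ is the random (binomial) subset of $\Gamma$ which includes each element of $\Gamma$ independently with probability $p$. Thus $X=|\mathcal H[\Gamma_p]|$ counts the edges of $\mathcal H$ entirely present in $\Gamma_p$, and $\mathbb E X=|\mathcal H|p^k=\mu$. For $j=0,1,\dots,k$, $\Delta_j=\max_{S\subseteq\Gamma,\,|S|=j}|\{T\in\mathcal H: T\supseteq S\}|$ is the maximum number of edges containing $j$ given vertices. *)

(* Defs.v *)
From HB Require Import structures.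
From mathcomp Require Import all_boot all_order all_algebra.
From mathcomp Require Import reals.
Set Implicit Arguments.
Unset Strict Implicit.
Unset Printing Implicit Defensive.
Import Order.TTheory GRing.Theory Num.Theory.
Local Open Scope ring_scope.

(* A hypergraph on the finite vertex type G is its set of edges,
   H : {set {set G}}. *)
Definition uniform (G : finType) (k : nat) (H : {set {set G}}) : Prop :=
  forall T : {set G}, T \in H -> #|T| = k.

Definition induced (G : finType) (H : {set {set G}}) (A : {set G}) :
    {set {set G}} :=
  [set T in H | T \subset A].

(* Equal to 0 when j exceeds the number of vertices. *)
Definition max_degree (G : finType) (H : {set {set G}}) (j : nat) : nat :=
  \max_(S : {set G} | #|S| == j) #|[set T in H | S \subset T]|.

(* The law of the binomial random subset: P(G_p = A), a product over the
   vertices because the inclusions are independent. *)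
Definition binomial_subset_pmf (R : realType) (G : finType) (p : R)
    (A : {set G}) : R :=
  \prod_(v : G) (if v \in A then p else 1 - p).

(* The probability that G_p satisfies E. *)
Definition binomial_subset_prob (R : realType) (G : finType) (p : R)
    (E : pred {set G}) : R :=
  \sum_(A : {set G} | E A) binomial_subset_pmf p A.

Lemma binomial_subset_prob_sub (R : realType) (G : finType) (p : R)
    (S : {set G}) :
  binomial_subset_prob p (fun A => S \subset A) = p ^+ #|S|.
Proof.
rewrite /binomial_subset_prob /binomial_subset_pmf.
transitivity (\prod_(v : G) (p + (if v \in S then 0 else 1 - p))).
  rewrite bigA_distr big_mkcond /=; apply: eq_bigr => A _.
  case: ifPn => [/subsetP SA|/subsetPn[v vS vA]].
    apply: eq_bigr => v _; case: ifPn => // vA.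
    by case: ifPn => // /SA; rewrite (negPf vA).
  by rewrite (bigD1 v) //= (negPf vA) vS mul0r.
rewrite -prodr_const [RHS]big_mkcond /=; apply: eq_bigr => v _.
by case: ifP => _; [rewrite addr0 | rewrite addrC subrK].
Qed.

Lemma binomial_subset_prob_total (R : realType) (G : finType) (p : R) :
  binomial_subset_prob (G := G) p predT = 1.
Proof.
rewrite -(expr0 p) -(cards0 G) -binomial_subset_prob_sub.
by apply: eq_bigl => A; rewrite sub0set.
Qed.

Lemma binomial_subset_mean_edges (R : realType) (G : finType) (p : R) (k : nat)
    (H : {set {set G}}) (hH : uniform k H) :
  \sum_(A : {set G}) binomial_subset_pmf p A * #|induced H A|%:R
    = #|H|%:R * p ^+ k.
Proof.
transitivity (\sum_(T in H) binomial_subset_prob p (fun A => T \subset A)).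
  rewrite [RHS](exchange_big_dep predT) //=; apply: eq_bigr => A _.
  rewrite mulr_natr -sumr_const; apply: eq_bigl => T.
  by rewrite inE.
rewrite (eq_bigr (fun=> p ^+ k)) => [|T /hH <-].
  by rewrite sumr_const mulr_natl.
exact: binomial_subset_prob_sub.
Qed.

(* Main.v *)
Require Import Defs.
From HB Require Import structures.
From mathcomp Require Import all_boot all_order all_algebra.
From mathcomp Require Import reals sequences exp.
From mathcomp Require Import ring.
Set Implicit Arguments.
Unset Strict Implicit.
Unset Printing Implicit Defensive.
Import Order.TTheory GRing.Theory Num.Theory.
Local Open Scope ring_scope.

(** The lower bound holds because [p ^+ #|G0|] is the probability that the
    random set contains G0, an event on which X is already at least t mu.

    The upper bound is Markov's inequality for a moment X^m whose order m is of
    the size of s = mu^(1/q).  Expanding X^m as a sum over m-tuples of edges,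
    the expectation is the sum of p^(size of the union of the tuple).  When
    edges are added one at a time to a set U already present, a new edge T
    costs the factor p^|T \ U|, so everything rests on bounding
    the sum of p^|T \ U| over all edges T by (1 + t) / 2 * mu as long as U has
    at most delta s vertices, for a small constant delta
    ([moment_le] turns this into E X^m <= ((1 + t) / 2 * mu)^m).

    The edges disjoint from U contribute at most mu.  For the others, put
    r = p^(k/q); since q <= k, an edge meeting U in i vertices has
    p^(k-i) <= r^(q - min(i, q)).  At most |U|^j Delta_j edges meet U
    in j or more vertices ([card_meet_le]), so the excess is at most
    the sum over 1 <= j <= q of K |U|^j (N r)^(q-j).  Hypothesis (i) says
    that N r = O(s), so each such term is O(delta s^q) = O(delta mu)
    ([extension_sum_le]).  Thus delta can be chosen, in terms of
    k, q, a0, t, K only, to make the excess at most (t - 1) / 2 * mu.  With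
    m > delta s / k, Markov's inequality gives
    P(X >= t mu) <= ((1 + t) / (2 t))^m, which is exponentially small
    in s. *)

(** * Edges meeting a given set *)

Lemma bin_leq_expn (n j : nat) : ('C(n, j) <= n ^ j)%N.
Proof.
apply: (@leq_trans (n ^_ j)).
  by rewrite -bin_ffact leq_pmulr ?fact_gt0.
rewrite ffact_prod -[j in (_ ^ j)%N]card_ord -prod_nat_const.
by apply: leq_prod => i _; rewrite leq_subr.
Qed.

Lemma degree_le_max (G : finType) (H : {set {set G}}) (S : {set G}) :
  (#|[set T in H | S \subset T]| <= max_degree H #|S|)%N.
Proof. exact: (leq_bigmax_cond S). Qed.

(** An edge meeting U in at least j vertices contains some j-subset of U, and
    U has at most #|U| ^ j of those. *)
Lemma card_meet_le (G : finType) (H : {set {set G}}) (U : {set G}) (j : nat) :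
  (#|[set T in H | j <= #|T :&: U|]| <= #|U| ^ j * max_degree H j)%N.
Proof.
pose J := [set S : {set G} | S \subset U & #|S| == j].
have cover T : (j <= #|T :&: U|)%N -> (1 <= #|[set S in J | S \subset T]|)%N.
  rewrite -bin_gt0 -cards_draws => /card_gt0P[S]; rewrite inE subsetI.
  by case/andP => /andP[ST SU] Sj; apply/card_gt0P; exists S; rewrite !inE SU Sj.
apply: (@leq_trans (\sum_(T in H) #|[set S in J | S \subset T]|)%N).
  rewrite -sum1_card (eq_bigl (fun T => (T \in H) && (j <= #|T :&: U|)%N)).
    by rewrite big_mkcondr; apply: leq_sum => T _; case: ifP => // /cover.
  by move=> T; rewrite inE.
rewrite (eq_bigr (fun T : {set G} => \sum_(S in J | S \subset T) 1)%N); last first.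
  by move=> T _; rewrite -sum1_card; apply: eq_bigl => S; rewrite inE.
rewrite (exchange_big_dep (mem J)) //=; last by move=> T S _ /andP[].
apply: (@leq_trans (\sum_(S in J) max_degree H j)%N).
  apply: leq_sum => S; rewrite inE => /andP[SU /eqP Sj].
  rewrite sum1_card -Sj; apply: leq_trans (degree_le_max H S).
  apply/eq_leq/eq_card => T.
  by rewrite /= !inE /in_mem /= SU eqxx.
by rewrite sum_nat_const cards_draws leq_mul2r bin_leq_expn orbT.
Qed.

(** * The expected number of edges added to a small set *)

(** Taking r for the q-th root of p ^+ k, this interpolates between p ^+ k
    at i = 0 and 1 at i >= q; the inequality uses r <= p, which is where
    q <= k enters. *)
Lemma expr_sub_le_root (R : realFieldType) (p r : R) (k q i : nat) :
  0 < p <= 1 -> 0 <= r -> (0 < q <= k)%N -> r ^+ q = p ^+ k ->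
  p ^+ (k - i) <= r ^+ (q - minn i q).
Proof.
move=> /andP[p0 p1] r0 /andP[q0 qk] rq.
have rp : r <= p.
  rewrite -(@ler_pXn2r _ q) ?nnegrE ?(ltW p0) // rq.
  by rewrite ler_wiXn2l // (ltW p0).
case: (leqP i q) => [iq|/ltnW iq]; last first.
  by rewrite subnn expr0 exprn_ile1 // ltW.
rewrite -(@ler_pM2r _ (p ^+ i)) ?exprn_gt0 // -exprD subnK ?(leq_trans iq) //.
rewrite -rq -{1}(subnK iq) exprD ler_wpM2l ?exprn_ge0 //.
by rewrite lerXn2r ?nnegrE // ltW.
Qed.

Lemma extension_sum_le_meet (R : realFieldType) (G : finType)
    (H : {set {set G}}) (U : {set G}) (p r : R) (k q : nat) :
  uniform k H -> 0 < p <= 1 -> 0 <= r -> (0 < q <= k)%N -> r ^+ q = p ^+ k ->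
  \sum_(T in H) p ^+ #|T :\: U| <= #|H|%:R * p ^+ k
    + \sum_(1 <= j < q.+1)
        #|[set T in H | (j <= #|T :&: U|)%N]|%:R * r ^+ (q - j).
Proof.
move=> Hk p01 r0 qk rq; have /andP[p0 p1] := p01.
have -> : \sum_(1 <= j < q.+1)
      #|[set T in H | (j <= #|T :&: U|)%N]|%:R * r ^+ (q - j)
    = \sum_(T in H) \sum_(1 <= j < q.+1 | (j <= #|T :&: U|)%N) r ^+ (q - j).
  rewrite (exchange_big_dep predT) //=; apply: eq_bigr => j _.
  rewrite mulr_natl -sumr_const; apply: eq_bigl => T.
  by rewrite inE.
rewrite mulr_natl -sumr_const -big_split /=; apply: ler_sum => T TH.
have TU : #|T :\: U| = (k - #|T :&: U|)%N.
  by rewrite -(Hk _ TH) -[in RHS](cardsID U T) addKn.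
have r_ge0 j : 0 <= r ^+ j by rewrite exprn_ge0.
have [i0|i0] := posnP #|T :&: U|.
  by rewrite TU i0 subn0 lerDl sumr_ge0.
rewrite TU (le_trans (expr_sub_le_root _ p01 r0 qk rq)) //.
set m := minn _ _.
have mq : m \in index_iota 1 q.+1.
  by rewrite mem_index_iota ltnS geq_minr leq_min i0; case/andP: qk => ->.
rewrite big_mkcond (bigD1_seq m) ?iota_uniq //= geq_minl.
rewrite addrCA lerDl addr_ge0 ?exprn_ge0 ?(ltW p0) //.
by apply: sumr_ge0 => l _; case: ifP.
Qed.

(** Read s as the q-th root of mu.  In the excess over the mean, the term of
    index j is at most K (delta s)^j (B s)^(q - j): since j >= 1 and
    delta <= 1 <= B, it contains a full factor delta. *)
Lemma extension_sum_le (R : realFieldType) (G : finType)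
    (H : {set {set G}}) (U : {set G}) (p r s B K delta : R) (k q : nat) :
  uniform k H -> 0 < p <= 1 -> 0 <= r -> (0 < q <= k)%N -> r ^+ q = p ^+ k ->
  0 < K -> 0 <= s -> 1 <= B -> 0 <= delta <= 1 ->
  #|G|%:R * r <= B * s -> #|U|%:R <= delta * s ->
  (forall j, (j <= q)%N -> (max_degree H j)%:R <= K * #|G|%:R ^+ (q - j)) ->
  \sum_(T in H) p ^+ #|T :\: U|
    <= #|H|%:R * p ^+ k + q%:R * (K * (delta * B ^+ q * s ^+ q)).
Proof.
move=> Hk p01 r0 qk rq K0 s0 B1 /andP[d0 d1] Nr Us deg.
have B0 : 0 <= B by rewrite (le_trans ler01).
apply: le_trans (extension_sum_le_meet U Hk p01 r0 qk rq) _.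
rewrite lerD2l.
have -> : q%:R * (K * (delta * B ^+ q * s ^+ q))
    = \sum_(1 <= j < q.+1) K * (delta * B ^+ q * s ^+ q).
  by rewrite sumr_const_nat subSS subn0 mulr_natl.
apply: ler_sum_nat => j /andP[j1 jq]; rewrite ltnS in jq.
have meet : #|[set T in H | (j <= #|T :&: U|)%N]|%:R
    <= #|U|%:R ^+ j * (K * #|G|%:R ^+ (q - j)) :> R.
  apply: (@le_trans _ _ ((#|U| ^ j * max_degree H j)%N%:R)).
    by rewrite ler_nat card_meet_le.
  by rewrite natrM natrX ler_wpM2l ?exprn_ge0 ?deg.
apply: (@le_trans _ _ (K * (#|U|%:R ^+ j * (#|G|%:R * r) ^+ (q - j)))).
  apply: le_trans (ler_wpM2r (exprn_ge0 _ r0) meet) _.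
  by rewrite mulrCA -mulrA -mulrA exprMn.
rewrite ler_wpM2l ?(ltW K0) //.
apply: (@le_trans _ _ ((delta * s) ^+ j * (B * s) ^+ (q - j))).
  by rewrite ler_pM ?exprn_ge0 ?mulr_ge0 // lerXn2r ?nnegrE ?mulr_ge0.
rewrite !exprMn mulrACA -exprD subnKC // ler_wpM2r ?exprn_ge0 //.
rewrite ler_pM ?exprn_ge0 //; last by rewrite ler_weXn2l // leq_subr.
by rewrite -[leRHS]expr1 ler_wiXn2l.
Qed.

(** * Moments of the number of edges *)

(** The moment E[X^m; U is contained in the random set]; keeping the set U
    makes induction on m possible. *)
Definition moment (R : realType) (G : finType) (H : {set {set G}}) (p : R)
    (m : nat) (U : {set G}) : R :=
  \sum_(A : {set G} | U \subset A)
    binomial_subset_pmf p A * #|induced H A|%:R ^+ m.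

Lemma momentS (R : realType) (G : finType) (H : {set {set G}}) (p : R)
    (m : nat) (U : {set G}) :
  moment H p m.+1 U = \sum_(T in H) moment H p m (U :|: T).
Proof.
rewrite /moment [RHS](exchange_big_dep (fun A : {set G} => U \subset A)) /=.
  apply: eq_bigr => A UA; rewrite exprSr mulrA mulr_natr -sumr_const.
  by apply: eq_bigl => T; rewrite inE subUset UA.
by move=> T A _; rewrite subUset => /andP[].
Qed.

(** Each of the m edges costs a factor lam, because U and the
    edges chosen before it cover at most L vertices. *)
Lemma moment_le (R : realType) (G : finType) (H : {set {set G}})
    (p lam : R) (k L m : nat) (U : {set G}) :
  uniform k H -> 0 <= p -> 0 <= lam ->
  (forall V : {set G}, (#|V| <= L)%N ->
     \sum_(T in H) p ^+ #|T :\: V| <= lam) ->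
  (#|U| + m * k <= L + k)%N ->
  moment H p m U <= p ^+ #|U| * lam ^+ m.
Proof.
move=> Hk p0 lam0 Hlam; elim: m U => [|m IH] U UL.
  rewrite expr0 mulr1 -(binomial_subset_prob_sub p U).
  by apply: ler_sum => A _; rewrite expr0 mulr1.
rewrite momentS.
apply: (@le_trans _ _
    (\sum_(T in H) p ^+ #|U| * lam ^+ m * p ^+ #|T :\: U|)).
  apply: ler_sum => T TH.
  apply: le_trans (IH _ _) _.
    apply: leq_trans UL; rewrite mulSn addnA leq_add2r.
    by rewrite -(Hk _ TH) cardsU leq_subr.
  rewrite mulrAC -exprD -cardsUI.
  have -> : U :|: (T :\: U) = U :|: T by rewrite setDE setUIr setUCr setIT.
  have -> : U :&: (T :\: U) = set0 by rewrite setDE setICA setICr setI0.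
  by rewrite cards0 addn0.
rewrite -mulr_sumr exprSr mulrA ler_wpM2l ?mulr_ge0 ?exprn_ge0 //.
apply: Hlam; move: UL; rewrite mulSn addnA addnAC leq_add2r.
exact/leq_trans/leq_addr.
Qed.

Lemma binomial_subset_pmf_ge0 (R : realType) (G : finType) (p : R)
    (A : {set G}) : 0 <= p <= 1 -> 0 <= binomial_subset_pmf p A.
Proof.
move=> /andP[p0 p1]; apply: prodr_ge0 => v _.
by case: ifP => // _; rewrite subr_ge0.
Qed.

Lemma binomial_subset_markov (R : realType) (G : finType)
    (H : {set {set G}}) (p x : R) (m : nat) :
  0 <= p <= 1 -> 0 <= x ->
  binomial_subset_prob p (fun A => x <= #|induced H A|%:R) * x ^+ m
    <= moment H p m set0.
Proof.
move=> p01 x0; rewrite /binomial_subset_prob mulr_suml /moment.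
rewrite big_mkcond [leRHS]big_mkcond; apply: ler_sum => A _.
rewrite sub0set; have pmf0 := binomial_subset_pmf_ge0 A p01.
case: ifP => xA; last by rewrite mulr_ge0 ?exprn_ge0.
by rewrite ler_wpM2l // lerXn2r ?nnegrE.
Qed.

(** If the random set contains W, it inherits every edge inside W. *)
Lemma prob_ge_planted (R : realType) (G : finType) (H : {set {set G}})
    (p x : R) (W : {set G}) :
  0 <= p <= 1 -> x <= #|induced H W|%:R ->
  p ^+ #|W| <= binomial_subset_prob p (fun A => x <= #|induced H A|%:R).
Proof.
move=> p01 xW; rewrite -binomial_subset_prob_sub /binomial_subset_prob.
rewrite big_mkcond [leRHS]big_mkcond; apply: ler_sum => A _.
have pmf0 := binomial_subset_pmf_ge0 A p01.
case: ifP => WA; last by case: ifP.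
rewrite (le_trans xW) // ler_nat subset_leq_card //.
by apply/subsetP => T; rewrite !inE => /andP[->] /subset_trans; apply.
Qed.

(** * The two tail bounds *)

(** Markov's inequality for the moment of order m = truncn (eps * s) + 1.  Only
    the first m - 1 edges of a tuple are ever looked at as a covered set, and
    they have at most k * eps * s vertices; yet m > eps * s, so the bound holds
    for every s, however small. *)
Lemma upper_tail_le (R : realType) (G : finType) (H : {set {set G}})
    (k : nat) (p eps s lam x : R) :
  uniform k H -> 0 <= p <= 1 -> 0 <= eps -> 0 <= s -> 0 < lam < x ->
  (forall V : {set G}, #|V|%:R <= k%:R * eps * s ->
     \sum_(T in H) p ^+ #|T :\: V| <= lam) ->
  binomial_subset_prob p (fun A => x <= #|induced H A|%:R)
    <= expR (- (- ln (lam / x) * eps * s)).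
Proof.
move=> Hk p01 eps0 s0 /andP[lam0 lamx] Hlam.
have x0 := lt_trans lam0 lamx; have es0 : 0 <= eps * s by rewrite mulr_ge0.
pose m := (Num.truncn (eps * s)).+1.
have rho0 : 0 < lam / x by rewrite divr_gt0.
have mom : moment H p m set0 <= lam ^+ m.
  rewrite -[leRHS]mul1r -(expr0 p) -(cards0 G).
  apply: (@moment_le _ _ _ _ _ k (k * Num.truncn (eps * s))) => //.
  - by case/andP: p01.
  - exact: ltW.
  - move=> V VL; apply: Hlam; apply: le_trans (_ : _ <= (k * _)%N%:R) _.
      by rewrite ler_nat; exact: VL.
    by rewrite natrM -mulrA ler_wpM2l // truncn_le.
  - by rewrite cards0 mulSn add0n addnC mulnC.
have := le_trans (binomial_subset_markov H m p01 (ltW x0)) mom.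
rewrite -ler_pdivlMr ?exprn_gt0 // -expr_div_n => /le_trans; apply.
rewrite -[in leLHS](lnK rho0) -expRM_natl ler_expR.
rewrite mulNr mulNr opprK -mulrA mulrC ler_wnM2l //.
  by rewrite ln_le0 // ler_pdivrMr // mul1r ltW.
exact/ltW/truncnS_gt.
Qed.

Theorem theorem2p1 (R : realType) (k q : nat) (a0 t K : R)
    (hk : (1 <= k)%N) (hq1 : (1 <= q)%N) (hqk : (q <= k)%N)
    (ha0 : 0 < a0) (ht : 1 < t) (hK : 0 < K) :
  exists2 c : R, 0 < c &
    forall (G : finType) (H : {set {set G}}) (p C : R),
      let N : nat := #|G| in
      let mu : R := #|H|%:R * p ^+ k in
      let X : {set G} -> nat := fun A => #|induced H A| in
      uniform k H ->
      (1 <= N)%N ->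
      0 < p < 1 ->
      a0 <= #|H|%:R / N%:R ^+ q ->
      (forall j : nat, (j <= q)%N ->
         (max_degree H j)%:R <= K * N%:R ^+ (q - j)) ->
      (forall j : nat, (q < j <= k)%N -> (max_degree H j)%:R <= K) ->
      0 < C ->
      (exists G0 : {set G},
         #|G0|%:R <= C * mu `^ (1 / q%:R) /\ t * mu <= (X G0)%:R) ->
      [/\ p `^ (C * mu `^ (1 / q%:R))
            = expR (- (C * mu `^ (1 / q%:R) * ln (1 / p))),
          expR (- (C * mu `^ (1 / q%:R) * ln (1 / p)))
            <= binomial_subset_prob p (fun A => t * mu <= (X A)%:R)
        & binomial_subset_prob p (fun A => t * mu <= (X A)%:R)
            <= expR (- (c * mu `^ (1 / q%:R)))].
Proof.
(* B makes B ^+ q >= a0^-1 and B >= 1 without a q-th root; eps keeps k * eps,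
   the fraction of s that a tuple of edges may cover, both at most 1 and small
   enough for the excess over the mean. *)
pose B := Num.max 1 a0^-1.
pose eps := Num.min k%:R^-1 ((t - 1) / 2 / (q%:R * K * B ^+ q * k%:R)).
pose rho := (1 + t) / 2 / t.
have q0 : 0 < q%:R :> R by rewrite ltr0n.
have k0 : 0 < k%:R :> R by rewrite ltr0n.
have t0 : 0 < t by rewrite (lt_trans ltr01).
have B1 : 1 <= B by rewrite le_max lexx.
have B0 : 0 < B by rewrite (lt_le_trans ltr01).
have D0 : 0 < q%:R * K * B ^+ q * k%:R by rewrite !mulr_gt0 ?exprn_gt0.
have eps0 : 0 < eps.
  by rewrite lt_min invr_gt0 k0 !divr_gt0 // subr_gt0.
have rho0 : 0 < rho by rewrite !divr_gt0 ?addr_gt0.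
have half_lt : (1 + t) / 2 < t.
  by rewrite ltr_pdivrMr // mulr_natr mulr2n ltrD2r.
have rho1 : rho < 1 by rewrite ltr_pdivrMr // mul1r.
exists (- ln rho * eps) => [|G H p C N mu X Hk N1 p01 Ha deg _ C0 [W [Ws XW]]].
  by rewrite mulr_gt0 // oppr_gt0 ln_lt0 // rho0.
have /andP[p0 p1] := p01.
have p01' : 0 <= p <= 1 by rewrite !ltW.
have N0 : 0 < N%:R :> R by rewrite ltr0n.
have a0H : a0 * N%:R ^+ q <= #|H|%:R by rewrite -ler_pdivlMr // exprn_gt0.
have mu0 : 0 < mu.
  by rewrite mulr_gt0 ?exprn_gt0 // (lt_le_trans _ a0H) // mulr_gt0 ?exprn_gt0.
set s := mu `^ (1 / q%:R).
have s0 : 0 <= s by exact: powR_ge0.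
have sq : s ^+ q = mu.
  by rewrite -powR_mulrn // -powRrM mul1r mulVf ?gt_eqF // powRr1 // ltW.
have pE : p `^ (C * s) = expR (- (C * s * ln (1 / p))).
  by rewrite /powR gt_eqF // div1r lnV ?posrE // mulrN opprK.
split=> //.
  rewrite -pE (le_trans _ (prob_ge_planted p01' XW)) //.
  by rewrite -powR_mulrn ?ger_powR ?p0 ?(ltW p0) ?(ltW p1).
have -> : rho = ((1 + t) / 2 * mu) / (t * mu).
  by rewrite -mulf_div divff ?gt_eqF // mulr1.
apply: (upper_tail_le Hk p01' (ltW eps0) s0) => [|V Vs].
  by rewrite mulr_gt0 ?divr_gt0 ?addr_gt0 //= ltr_pM2r.
pose r := p `^ (k%:R / q%:R).
have rq : r ^+ q = p ^+ k.
  by rewrite -powR_mulrn ?powR_ge0 // -powRrM divfK ?gt_eqF // powR_mulrn // ltW.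
(* This is hypothesis (i), multiplied by p ^+ k and read on q-th roots. *)
have Nr : N%:R * r <= B * s.
  rewrite -(@ler_pXn2r _ q) ?nnegrE ?mulr_ge0 ?powR_ge0 ?(ltW B0) //.
  rewrite !exprMn rq sq /mu mulrA ler_wpM2r ?exprn_ge0 ?(ltW p0) //.
  apply: (@le_trans _ _ (a0^-1 * #|H|%:R)).
    by rewrite -ler_pdivrMl ?invr_gt0 // invrK.
  rewrite ler_wpM2r // (@le_trans _ _ B) ?le_max ?lexx ?orbT //.
  by rewrite -[leLHS]expr1 ler_weXn2l.
have eps_k : 0 <= k%:R * eps <= 1.
  rewrite mulr_ge0 ?(ltW eps0) //= -ler_pdivlMl // mulr1.
  by rewrite ge_min lexx.
have qk : (0 < q <= k)%N by rewrite hq1.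
have p01'' : 0 < p <= 1 by rewrite p0 ltW.
apply: le_trans (extension_sum_le Hk p01'' (powR_ge0 _ _) qk rq hK s0 B1
  eps_k Nr Vs deg) _.
have excess : q%:R * K * B ^+ q * k%:R * eps <= (t - 1) / 2.
  by rewrite mulrC -ler_pdivlMr // ge_min lexx orbT.
rewrite sq -/mu.
have -> : (1 + t) / 2 * mu = mu + (t - 1) / 2 * mu.
  by field.
rewrite lerD2l; apply: le_trans (ler_wpM2r (ltW mu0) excess).
by rewrite le_eqVlt; apply/predU1l; ring.
Qed.
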